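(* Consider the stability-constrained OPF problem $\mathcal P_1$ (defined in the context) with the quadratic objective $$J_{\mathrm{obj}}(x;\rho)=\sum_{i\in\mathcal G}\big(c_iP_{G,i}^2+b_iP_{G,i}+a_i+d_iQ_{G,i}^2\big),\qquad \rho:=(b,c,d)\in\mathbb R^{3|\mathcal G|},$$ where $a_i,b_i,c_i,d_i\ge0$. Let $s\in\{1,\dots,L\}$ and let $x^\star$ be a feasible point at which the stability constraint $h_s$ is the only active inequality constraint, i.e. $g(x^\star)=0$, $h_s(x^\star)=0$, $h_\ell(x^\star)<0$ for all $\ell\ne s$, and all operational inequality constraints hold strictly; assume that $\nabla_xg(x^\star)$ has full row rank. Let $x=\Phi(z)$ be a local parametrization of $\{x:g(x)=0\}$ near $x^\star=\Phi(z^\star)$, and let $A(x^\star)$ be the matrix mapping the objective parameters to the reduced gradient of the objective, i.e. $\nabla_zJ_{\mathrm{obj}}(x^\star;\rho)=A(x^\star)\,\rho$. If there exist coefficients $\rho$ with at least one $d_i>0$ and a scalar $\mu_s^\star>0$ such that $$A(x^\star)\,\rho+\mu_s^\star\,\nabla_zh_s(x^\star)=0,$$ and if the second-order sufficient condition (SOSC) holds for the reduced problem at $z^\star$ with multiplier $\mu_s^\star$, then (for these coefficients $\rho$) $x^\star$ is a strict local minimizer of $\mathcal P_1$, and the stability constraint $h_s$ is independently binding at $x^\star$ with positive shadow price $\mu_s^\star>0$.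
   Context: Network. A connected graph $\mathcal H=(\mathcal N,\mathcal E)$ with bus set $\mathcal N$ (bus $1$ is the reference bus) and line set $\mathcal E$; $\mathcal N_i$ is the set of neighbors of bus $i$; $\mathcal G\subseteq\mathcal N$ is the set of inverter (generator) buses; $B=(B_{ij})$ is the real symmetric susceptance matrix of the lossless network. Stability constraints. For $\ell=1,\dots,L$, $h_\ell:=\alpha_\ell^\top V-\Gamma_\ell\le 0$, where $V=(V_i)_{i\in\mathcal G}$ is the vector of inverter voltage magnitudes, $\alpha_\ell\in\mathbb R^{|\mathcal G|}$ satisfies $\alpha_\ell^\top\mathbf 1=0$, and $\Gamma_\ell>0$; $h_\ell$ is regarded as a function of $x$ through $V$. Problem $\mathcal P_1$. Decision variables $x=(\{P_{G,i},Q_{G,i}\}_{i\in\mathcal G},\{V_i,\theta_i\}_{i\in\mathcal N})$; for $i\in\mathcal N\setminus\mathcal G$ set $P_{G,i}=Q_{G,i}=0$; $P_{D,i},Q_{D,i}$ are given load demands. Minimize the objective $J_{\mathrm{obj}}$ subject to: - equality constraints, collectively written $g(x)=0$: $\theta_1=0$; $P_{G,i}-P_{D,i}=-\sum_{j\in\mathcal N_i}V_iV_jB_{ij}\sin(\theta_i-\theta_j)$ and $Q_{G,i}-Q_{D,i}=V_i^2B_{ii}+\sum_{j\in\mathcal N_i}V_iV_jB_{ij}\cos(\theta_i-\theta_j)$ for all $i\in\mathcal N$; - operational inequality constraints: $\underline P_{G,i}\le P_{G,i}\le\overline P_{G,i}$ and $\underline Q_{G,i}\le Q_{G,i}\le\overline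 Q_{G,i}$ for $i\in\mathcal G$; $\underline V_i\le V_i\le\overline V_i$ for $i\in\mathcal N$; $\big(V_i^2B_{ij}-V_iV_jB_{ij}\cos(\theta_i-\theta_j)\big)^2+V_i^2V_j^2B_{ij}^2\sin^2(\theta_i-\theta_j)\le\overline S_{ij}^2$ for $(i,j)\in\mathcal E$; - stability constraints: $h_\ell\le 0$, $\ell=1,\dots,L$. Terminology. The shadow price of an inequality constraint is its Lagrange multiplier in the KKT conditions. A stability constraint $h_s$ is independently binding at a point if it is the only active inequality constraint there. A local parametrization of $\{x:g(x)=0\}$ near $x^\star$ is a smooth map $\Phi$ defined near some $z^\star$ with $\Phi(z^\star)=x^\star$, whose Jacobian $J_\Phi(z^\star)$ is injective with range $\{v:\nabla_xg(x^\star)v=0\}$, and which parametrizes $\{x:g(x)=0\}$ near $x^\star$; $z$ are the local free variables. Reduced gradients are $\nabla_zF(x^\star):=J_\Phi(z^\star)^\top\nabla_xF(x^\star)$. The reduced problem is $\min_zJ_{\mathrm{obj}}(\Phi(z);\rho)$ subject to $h_s(\Phi(z))\le0$. The SOSC for the reduced problem at $z^\star$ with multiplier $\mu>0$: $w^\top\nabla_{zz}^2\big[J_{\mathrm{obj}}(\Phi(z);\rho)+\mu\,h_s(\Phi(z))\big]_{z=z^\star}w>0$ for all $w\neq0$ with $\nabla_zh_s(x^\star)^\top w=0$. *)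

(* Defs.v *)
From HB Require Import structures.
From mathcomp Require Import all_boot all_order all_algebra.
From mathcomp Require Import all_classical all_reals all_analysis.

Set Implicit Arguments.
Unset Strict Implicit.
Unset Printing Implicit Defensive.
Import Order.TTheory GRing.Theory Num.Theory.
Import numFieldNormedType.Exports.
Local Open Scope classical_set_scope.
Local Open Scope ring_scope.

(* Points are row vectors and gradients are column vectors.  The library's    *)
(* ['J f x] acts on row vectors from the right, so it is the transpose of the *)
(* usual Jacobian matrix: the directional derivative along v is [v *m 'J f x] *)
(* and the usual [J_f^T *m w] is ['J f x *m w].                               *)

Definition grad (R : realType) n (F : 'rV[R]_n -> R) (x : 'rV[R]_n) : 'cV[R]_n :=
  \col_i 'D_(delta_mx 0 i) F x.

Definition hessian (R : realType) n (F : 'rV[R]_n -> R) (x : 'rV[R]_n) :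
    'M[R]_n :=
  \matrix_(i, j) 'D_(delta_mx 0 i) ('D_(delta_mx 0 j) F) x.

Fixpoint Ck_on (R : realType) n (V : normedModType R) (k : nat)
    (W : set 'rV[R]_n) (f : 'rV[R]_n -> V) : Prop :=
  match k with
  | 0 => forall x, W x -> {for x, continuous f}
  | k'.+1 => (forall x, W x -> differentiable f x) /\
             (forall i : 'I_n, Ck_on k' W ('D_(delta_mx 0 i) f))
  end.

Definition smooth_on (R : realType) n (V : normedModType R)
    (W : set 'rV[R]_n) (f : 'rV[R]_n -> V) : Prop :=
  forall k, Ck_on k W f.

(* "Phi parametrizes {g = 0} near xs" is read in the usual sense of           *)
(* submanifold theory: on some open neighbourhood W of zs, Phi is smooth and  *)
(* a homeomorphism, with inverse Psi, onto a relatively open neighbourhood    *)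
(* U `&` {g = 0} of xs.                                                       *)
Definition local_parametrization (R : realType) k n m
    (g : 'rV[R]_n -> 'rV[R]_m) (xs : 'rV[R]_n)
    (Phi : 'rV[R]_k -> 'rV[R]_n) (zs : 'rV[R]_k) : Prop :=
  [/\ Phi zs = xs,
      row_free ('J Phi zs),
      forall v : 'rV[R]_n, (v <= 'J Phi zs)%MS <-> v *m 'J g xs = 0
    & exists (W : set 'rV[R]_k) (U : set 'rV[R]_n) (Psi : 'rV[R]_n -> 'rV[R]_k),
        [/\ open W /\ W zs,
            open U /\ U xs,
            smooth_on W Phi,
            Phi @` W = U `&` [set x | g x = 0]
          & {within U `&` [set x | g x = 0], continuous Psi} /\
            forall z, W z -> Psi (Phi z) = z]].

Definition reduced_grad (R : realType) k n (Phi : 'rV[R]_k -> 'rV[R]_n)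
    (zs : 'rV[R]_k) (F : 'rV[R]_n -> R) : 'cV[R]_k :=
  'J Phi zs *m grad F (Phi zs).

(* SOSC for min F (Phi z) subject to h (Phi z) <= 0, where h is active at zs  *)
(* and mu > 0 is its multiplier.                                              *)
Definition reduced_SOSC (R : realType) k n (Phi : 'rV[R]_k -> 'rV[R]_n)
    (zs : 'rV[R]_k) (F h : 'rV[R]_n -> R) (mu : R) : Prop :=
  forall w : 'cV[R]_k, w != 0 ->
    (reduced_grad Phi zs h)^T *m w = 0 ->
    0 < (w^T *m hessian (fun z => F (Phi z) + mu * h (Phi z)) zs *m w) 0 0.

(* The reference bus is [ord0].  A line is recorded as an ordered pair because *)
(* the flow limit below is not symmetric in its two ends; the lines may list  *)
(* one or both orientations.  Quantities attached to inverters are indexed by *)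
(* 'I_#|gens|, the k-th inverter sitting at bus [enum_val k].                 *)
Record opf (R : realType) := Opf {
  nbus : nat;
  bus := 'I_nbus.+1;
  lines : {set bus * bus};
  gens : {set bus};
  inv := 'I_#|gens|;
  nstab : nat;
  adj : rel bus := fun i j => ((i, j) \in lines) || ((j, i) \in lines);
  adj_irrefl : irreflexive adj;
  adj_connected : forall i j, connect adj i j;
  susc : 'M[R]_nbus.+1;
  susc_sym : susc^T = susc;
  PD : bus -> R;
  QD : bus -> R;
  Pmin : inv -> R;
  Pmax : inv -> R;
  Qmin : inv -> R;
  Qmax : inv -> R;
  Vmin : bus -> R;
  Vmax : bus -> R;
  Smax : bus -> bus -> R;
  alpha : 'I_nstab -> 'cV[R]_#|gens|;
  alpha_sum0 : forall l, \sum_k alpha l k 0 = 0;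
  Gamma : 'I_nstab -> R;
  Gamma_gt0 : forall l, 0 < Gamma l
}.

Notation xdim O := ((#|gens O| + #|gens O|) + ((nbus O).+1 + (nbus O).+1))%N.
Notation gdim O := (1 + ((nbus O).+1 + (nbus O).+1))%N.
Notation rhodim O := (#|gens O| + (#|gens O| + #|gens O|))%N.

Section Problem.
Context {R : realType} (O : opf R).
Implicit Types (x : 'rV[R]_(xdim O)) (k : 'I_#|gens O|) (i j : 'I_(nbus O).+1).

(* x = (P_G, Q_G, V, theta) *)
Definition PG x k : R := lsubmx (lsubmx x) 0 k.
Definition QG x k : R := rsubmx (lsubmx x) 0 k.
Definition Vm x i : R := lsubmx (rsubmx x) 0 i.
Definition theta x i : R := rsubmx (rsubmx x) 0 i.

(* The injections at a bus: the sum has one term at an inverter bus, and none *)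
(* at a bus outside [gens].                                                   *)
Definition PGbus x i : R := \sum_(k | enum_val k == i) PG x k.
Definition QGbus x i : R := \sum_(k | enum_val k == i) QG x k.

Definition Pbalance x i : R :=
  PGbus x i - PD i
  + \sum_(j | adj i j) Vm x i * Vm x j * susc O i j * sin (theta x i - theta x j).

Definition Qbalance x i : R :=
  QGbus x i - QD i
  - (Vm x i ^+ 2 * susc O i i
     + \sum_(j | adj i j)
         Vm x i * Vm x j * susc O i j * cos (theta x i - theta x j)).

Definition eqcon x : 'rV[R]_(gdim O) :=
  row_mx (\row__ theta x ord0)
         (row_mx (\row_i Pbalance x i) (\row_i Qbalance x i)).

Definition stab_con (l : 'I_(nstab O)) x : R :=
  \sum_k alpha l k 0 * Vm x (enum_val k) - Gamma l.

Definition line_con i j x : R :=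
  (Vm x i ^+ 2 * susc O i j
     - Vm x i * Vm x j * susc O i j * cos (theta x i - theta x j)) ^+ 2
  + Vm x i ^+ 2 * Vm x j ^+ 2 * susc O i j ^+ 2
      * sin (theta x i - theta x j) ^+ 2
  - Smax i j ^+ 2.

Inductive con :=
  | PGlo of 'I_#|gens O| | PGup of 'I_#|gens O|
  | QGlo of 'I_#|gens O| | QGup of 'I_#|gens O|
  | Vlo of 'I_(nbus O).+1 | Vup of 'I_(nbus O).+1
  | Line of {e | e \in lines O}
  | Stab of 'I_(nstab O).

Definition ineq (c : con) x : R :=
  match c with
  | PGlo k => Pmin k - PG x k
  | PGup k => PG x k - Pmax k
  | QGlo k => Qmin k - QG x k
  | QGup k => QG x k - Qmax k
  | Vlo i => Vmin i - Vm x i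
  | Vup i => Vm x i - Vmax i
  | Line e => line_con (val e).1 (val e).2 x
  | Stab l => stab_con l x
  end.

Definition con_code : Type :=
  (('I_#|gens O| + 'I_#|gens O|) + ('I_#|gens O| + 'I_#|gens O|)
   + ('I_(nbus O).+1 + 'I_(nbus O).+1)
   + ({e | e \in lines O} + 'I_(nstab O)))%type.

Definition con_encode (c : con) : con_code :=
  match c with
  | PGlo k => inl (inl (inl (inl k)))
  | PGup k => inl (inl (inl (inr k)))
  | QGlo k => inl (inl (inr (inl k)))
  | QGup k => inl (inl (inr (inr k)))
  | Vlo i => inl (inr (inl i))
  | Vup i => inl (inr (inr i))
  | Line e => inr (inl e)
  | Stab l => inr (inr l)
  end.

Definition con_decode (t : con_code) : con :=
  match t with
  | inl (inl (inl (inl k))) => PGlo k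
  | inl (inl (inl (inr k))) => PGup k
  | inl (inl (inr (inl k))) => QGlo k
  | inl (inl (inr (inr k))) => QGup k
  | inl (inr (inl i)) => Vlo i
  | inl (inr (inr i)) => Vup i
  | inr (inl e) => Line e
  | inr (inr l) => Stab l
  end.

Lemma con_encodeK : cancel con_encode con_decode.
Proof. by case. Qed.

HB.instance Definition _ := Finite.copy con (can_type con_encodeK).

Definition feasible x : Prop := eqcon x = 0 /\ forall c, ineq c x <= 0.

Definition strict_local_minimizer (J : 'rV[R]_(xdim O) -> R) x : Prop :=
  feasible x /\ \forall y \near x, feasible y -> y <> x -> J x < J y.

Definition independently_binding (s : 'I_(nstab O)) x : Prop :=
  forall c, ineq c x = 0 <-> c = Stab s.

Definition KKT (J : 'rV[R]_(xdim O) -> R) x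
    (lam : 'cV[R]_(gdim O)) (mu : con -> R) : Prop :=
  [/\ feasible x,
      grad J x + 'J eqcon x *m lam + \sum_c mu c *: grad (ineq c) x = 0,
      forall c, 0 <= mu c
    & forall c, mu c * ineq c x = 0].

Definition is_shadow_price (J : 'rV[R]_(xdim O) -> R) x (c : con) (p : R) :
    Prop :=
  exists lam mu, KKT J x lam mu /\ mu c = p.

(* rho = (b, c, d) *)
Definition rho_b (rho : 'cV[R]_(rhodim O)) k : R := usubmx rho k 0.
Definition rho_c (rho : 'cV[R]_(rhodim O)) k : R := usubmx (dsubmx rho) k 0.
Definition rho_d (rho : 'cV[R]_(rhodim O)) k : R := dsubmx (dsubmx rho) k 0.

Definition Jobj (a : 'I_#|gens O| -> R) (rho : 'cV[R]_(rhodim O)) x : R :=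
  \sum_k (rho_c rho k * PG x k ^+ 2 + rho_b rho k * PG x k + a k
          + rho_d rho k * QG x k ^+ 2).

End Problem.

(* Main.v *)
Require Import Defs.
From mathcomp Require Import all_boot all_order all_algebra.
From mathcomp Require Import all_classical all_reals all_analysis.
From mathcomp Require Import ring lra.
Set Implicit Arguments.
Unset Strict Implicit.
Unset Printing Implicit Defensive.
Import Order.TTheory GRing.Theory Num.Theory.
Import numFieldNormedType.Exports.
Local Open Scope classical_set_scope.
Local Open Scope ring_scope.

(* In the free variables z put F = Jobj o Phi, G = stab_con s o Phi and        *)
(* L = F + mu G.  Stationarity says grad L = 0, and by compactness of the unit *)
(* sphere the SOSC upgrades to a penalized bound                               *)
(*   w^T H w + c (grad G . w)^2 >= d |w|^2  for all w, with d > 0.             *)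
(* Since F(z) - F(zs) = L(z) - L(zs) - mu G(z), a second-order expansion of L  *)
(* and a first-order one of G make F(z) > F(zs) at every nearby z <> zs with   *)
(* G(z) <= 0; the homeomorphism Phi carries this to the feasible points near   *)
(* xs.  The multipliers of the equalities exist because                        *)
(* grad J + mu grad h annihilates the kernel of the Jacobian of g, which is    *)
(* the range of J_Phi.                                                         *)

(** A displacement z - zs with G(z) <= 0 need not be orthogonal to grad G, so positivity of the
    Hessian on that hyperplane does not apply to it directly. The penalized bound of
    [positive_on_kernel_penalized] covers every direction, and [SOSC_strict_local_min] pays for the
    penalty with the term -mu G and the linearization error of G, using [differentiable_taylor1] and
    [differentiable_taylor2]. The minimum obtained is over all points near xs with g = 0 and h_s <=
    0, which include the feasible ones. [kernel_orthogonal_mulmx] yields the equality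
    multipliers. *)

Lemma near_eq_differentiable (R : realType) (V W : normedModType R)
    (f g : V -> W) (a : V) :
  (\forall x \near a, f x = g x) -> differentiable f a -> differentiable g a.
Proof.
move=> fg /diff_locallyP[cf fE].
have gE : g \o shift a = cst (g a) + 'd f a +o_ 0 id.
  apply/eqaddoP => e e0; move/eqaddoP: fE => /(_ e e0) fe.
  have fg0 : \forall x \near (0 : V), f (x + a) = g (x + a).
    have := fg; rewrite (near_shift (0 : V) a).
    by apply: filterS => x /=; rewrite subr0.
  near=> x.
  suff -> : (g \o shift a - (cst (g a) + 'd f a)) x =
            (f \o shift a - (cst (f a) + 'd f a)) x by near: x.
  rewrite /= /GRing.add /= /GRing.opp /=.
  have <- : f (x + a) = g (x + a) by near: x.
  by rewrite (nbhs_singleton fg).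
by apply/diff_locallyP; rewrite (diff_unique cf gE).
Unshelve. all: by end_near. Qed.

(** * Taylor expansions in terms of [grad] and [hessian] *)

Lemma diffE_grad (R : realType) n (f : 'rV[R]_n -> R) (a w : 'rV[R]_n) :
  differentiable f a -> 'd f a w = (w *m grad f a) 0 0.
Proof.
move=> df; rewrite {1}(row_sum_delta w) raddf_sum mxE.
apply: eq_bigr => i _; rewrite mxE deriveE//.
exact: (linearZZ ('d f a)).
Qed.

Lemma differentiable_taylor1 (R : realType) n (f : 'rV[R]_n -> R)
    (a : 'rV[R]_n) (e : R) :
  differentiable f a -> 0 < e ->
  \forall w \near (0 : 'rV[R]_n),
    `|f (a + w) - f a - (w *m grad f a) 0 0| <= e * `|w|.
Proof.
move=> df e0; have /diff_locally/eqaddoP/(_ e e0) := df.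
apply: filterS => w; rewrite -diffE_grad// [a + w]addrC -addrA -opprD.
exact.
Qed.

Lemma norm_coord_le (R : realType) n (w : 'rV[R]_n) i : `|w 0 i| <= `|w|.
Proof.
rewrite [leRHS]/Num.Def.normr /= mx_normrE.
exact: (le_bigmax _ (fun ij : 'I_1 * 'I_n => `|w ij.1 ij.2|) (0, i)).
Qed.

Lemma quadratic_formE (R : realType) n (H : 'M[R]_n) (w : 'rV[R]_n) :
  (w *m H *m w^T) 0 0 = \sum_j w 0 j * \sum_i w 0 i * H i j.
Proof.
rewrite mxE; apply: eq_bigr => j _; rewrite !mxE mulrC; congr (_ * _).
Qed.

(** The second derivatives are taken at [a] only. The mean value theorem is therefore applied once,
    along the segment from a to a + w, to f minus its quadratic model; the derivative of that
    difference is a combination of first-order remainders of the partial derivatives at [a]. *)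
Lemma differentiable_taylor2 (R : realType) n (f : 'rV[R]_n -> R)
    (a : 'rV[R]_n) (e : R) :
  (\forall z \near a, differentiable f z) ->
  (forall i, differentiable ('D_(delta_mx 0 i) f) a) -> 0 < e ->
  \forall w \near (0 : 'rV[R]_n),
    `|f (a + w) - f a - (w *m grad f a) 0 0
      - 2^-1 * (w *m hessian f a *m w^T) 0 0| <= e * `|w| ^+ 2.
Proof.
move=> df ddf e0.
(* Each of the n coordinates contributes at most e' |w|^2; the successor keeps the divisor nonzero
   when n = 0. *)
pose e' := e / n.+1%:R.
have e'0 : 0 < e' by rewrite divr_gt0.
have ddf' : \forall w \near (0 : 'rV[R]_n), forall i : 'I_n,
    `|'D_(delta_mx 0 i) f (a + w) - 'D_(delta_mx 0 i) f a
      - (w *m grad ('D_(delta_mx 0 i) f) a) 0 0| <= e' * `|w|.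
  near=> w; near: w; apply: filter_forall => /= i.
  exact: differentiable_taylor1.
have df' : \forall w \near (0 : 'rV[R]_n), differentiable f (a + w).
  have := df; rewrite (near_shift (0 : 'rV[R]_n) a).
  by apply: filterS => x /=; rewrite subr0 addrC.
have /nbhs_normP[r /= r0 rP] : \forall w \near (0 : 'rV[R]_n), differentiable f (a + w) /\
  forall i : 'I_n, `|'D_(delta_mx 0 i) f (a + w) - 'D_(delta_mx 0 i) f a
      - (w *m grad ('D_(delta_mx 0 i) f) a) 0 0| <= e' * `|w|.
  by near=> w; split; near: w.
apply/nbhs_normP; exists r => //= w wr.
have wtr (t : R) : 0 <= t <= 1 -> ball_ [eta Num.Def.normr] (0 : 'rV[R]_n) r (t *: w).
  move=> /andP[t0 t1]; move: wr; rewrite /= !sub0r !normrN normrZ ger0_norm//.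
  by apply: le_lt_trans; rewrite ler_piMl.
(* [phi 1 - phi 0] is the remainder to be bounded, and [dphi] is the derivative of [phi], grouped
   into the remainders controlled by [ddf']. *)
pose phi t := f (a + t *: w) - t * (w *m grad f a) 0 0
   - t ^+ 2 * (2^-1 * (w *m hessian f a *m w^T) 0 0).
pose dphi t := \sum_i w 0 i * ('D_(delta_mx 0 i) f (a + t *: w)
   - 'D_(delta_mx 0 i) f a - ((t *: w) *m grad ('D_(delta_mx 0 i) f) a) 0 0).
have phi' (t : R) : 0 <= t <= 1 -> is_derive t 1 phi (dphi t).
  move=> /wtr /rP[dft _].
  have -> : dphi t = (w *m grad f (a + t *: w)) 0 0 - (w *m grad f a) 0 0
        - (2 * t) * (2^-1 * (w *m hessian f a *m w^T) 0 0).
    rewrite /dphi quadratic_formE.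
    under eq_bigr do rewrite !mulrBr.
    rewrite !sumrB; congr (_ - _ - _).
    - by rewrite mxE; apply: eq_bigr => i _; rewrite mxE.
    - by rewrite mxE; apply: eq_bigr => i _; rewrite mxE.
    - rewrite mulrACA mulfV ?pnatr_eq0// mul1r [RHS]mulr_sumr; apply: eq_bigr => i _.
      rewrite -scalemxAl mxE mulrCA; congr (_ * _); congr (_ * _).
      by rewrite mxE; apply: eq_bigr => j _; rewrite !mxE.
  rewrite -diffE_grad//.
  have daff : is_diff t (fun s : R => a + s *: w) (fun s : R => s *: w).
    rewrite [X in is_diff _ _ X](_ : _ = 0 + ( *:%R ^~ w)); last first.
      by apply/funext => x; rewrite /= [RHS]add0r.
    exact: is_diffD.
  have d1 : is_derive t 1 (fun s : R => f (a + s *: w)) ('d f (a + t *: w) w).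
    have dc := differentiableP dft.
    have dfc := is_diff_comp daff dc.
    apply: DeriveDef; first exact/derivable1_diffP.
    by rewrite deriveE// diff_val /= scale1r.
  have d2 c : is_derive t 1 (fun s : R => s * c) c.
    by apply: is_derive_eq; rewrite scaler0 add0r; exact: mulr1.
  have d3 c : is_derive t 1 (fun s : R => s ^+ 2 * c) (2 * t * c).
    apply: is_derive_eq.
    rewrite scaler0 add0r /GRing.scale /=; ring.
  exact: (is_deriveB (is_deriveB d1 (d2 _)) (d3 _)).
have [t /[!in_itv]/= t01 tE] :
    exists2 t, t \in `[0, 1]%R & phi 1 - phi 0 = dphi t * (1 - 0).
  apply: MVT_segment => //.
    by move=> t; rewrite in_itv/= => /andP[t0 t1]; apply: phi'; rewrite !ltW.
  apply: derivable_within_continuous => t; rewrite in_itv/= => t01.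
  by have [] := phi' _ t01.
have -> : f (a + w) - f a - (w *m grad f a) 0 0
      - 2^-1 * (w *m hessian f a *m w^T) 0 0 = dphi t.
  move: tE; rewrite subr0 mulr1 => <-; rewrite /phi scale1r scale0r addr0.
  ring.
have [_ fP] := rP _ (wtr _ t01).
apply: (le_trans (ler_norm_sum _ _ _)).
apply: (@le_trans _ _ (\sum_(i < n) (e' * `|w| ^+ 2))); last first.
  rewrite sumr_const card_ord -mulr_natr mulrAC ler_wpM2r ?sqr_ge0//.
  rewrite /e' mulrAC ler_pdivrMr// ler_wpM2l ?ler_nat//.
  exact: ltW.
apply: ler_sum => i _; rewrite normrM expr2 mulrA mulrC ler_pM ?norm_coord_le//.
apply: le_trans (fP i) _; rewrite ler_wpM2l ?(ltW e'0)// normrZ.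
by move: t01 => /andP[t0 t1]; rewrite ger0_norm// ler_piMl.
Unshelve. all: by end_near. Qed.

(** * Quadratic forms and the second-order sufficient condition *)

Lemma compact_unit_sphere (R : realType) n :
  compact [set w : 'rV[R]_n | `|w| = 1].
Proof.
apply: bounded_closed_compact.
  exists 1; split; first exact: num_real.
  by move=> M M1 w /= ->; exact: ltW.
rewrite (_ : mkset _ = Num.norm @^-1` [set 1 : R]); last by [].
by apply: closed_comp => [w _|]; [exact: norm_continuous|exact: closed_eq].
Qed.

Lemma continuous_mulmx_coord (R : realType) n (u : 'cV[R]_n) :
  continuous (fun w : 'rV[R]_n => (w *m u) 0 0).
Proof.
under eq_fun do rewrite mxE.
apply: continuous_big => [|i _ w]; first exact: add_continuous.
apply: (@continuousM _ _ (fun v : 'rV[R]_n => v 0 i) (fun=> u i 0)).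
  exact: coord_continuous.
exact: cst_continuous.
Qed.

Lemma continuous_quadratic_form (R : realType) n (H : 'M[R]_n) :
  continuous (fun w : 'rV[R]_n => (w *m H *m w^T) 0 0).
Proof.
under eq_fun do rewrite quadratic_formE.
apply: continuous_big => [|j _ w]; first exact: add_continuous.
apply: (@continuousM _ _ (fun v : 'rV[R]_n => v 0 j)
  (fun v : 'rV[R]_n => \sum_i v 0 i * H i j)); first exact: coord_continuous.
apply: continuous_big => [|i _ v]; first exact: add_continuous.
apply: (@continuousM _ _ (fun v : 'rV[R]_n => v 0 i) (fun=> H i j)).
  exact: coord_continuous.
exact: cst_continuous.
Qed.

(** This is Finsler's lemma. The part of the unit sphere where the form is nonpositive is compact
    and misses the kernel of u, so the penalty is bounded away from 0 there and a large multiple of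
    it outweighs the form. Compactness of the sphere then gives d, and homogeneity extends the bound
    to all w. *)
Lemma positive_on_kernel_penalized (R : realType) n (H : 'M[R]_n)
    (u : 'cV[R]_n) :
  (forall w : 'rV[R]_n, w != 0 -> w *m u = 0 -> 0 < (w *m H *m w^T) 0 0) ->
  exists c d : R, [/\ 0 <= c, 0 < d & forall w : 'rV[R]_n,
    d * `|w| ^+ 2 <= (w *m H *m w^T) 0 0 + c * (w *m u) 0 0 ^+ 2].
Proof.
move=> Hpos.
pose q (w : 'rV[R]_n) := (w *m H *m w^T) 0 0.
pose p (w : 'rV[R]_n) := (w *m u) 0 0 ^+ 2.
have cq : continuous q by exact: continuous_quadratic_form.
have cp : continuous p.
  pose l (w : 'rV[R]_n) := (w *m u) 0 0.
  by move=> w; apply: (@continuousM _ _ l l); exact: continuous_mulmx_coord.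
pose S := [set w : 'rV[R]_n | `|w| = 1].
have cS : compact S by exact: compact_unit_sphere.
have p_ge0 w : 0 <= p w by exact: sqr_ge0.
have [c c_ge0 cP] : exists2 c : R, 0 <= c & forall w, S w -> 0 < q w + c * p w.
  pose K := S `&` [set w | q w <= 0].
  have cK : compact K.
    apply: (@subclosed_compact _ _ S) => //; last by move=> w [].
    apply: closedI; first exact: compact_closed.
    rewrite (_ : mkset _ = q @^-1` [set x | x <= 0]); last by [].
    by apply: closed_comp => [w _|]; [exact: cq|exact: closed_le].
  have [K0|/set0P/negP/negPn/eqP K0] := pselect (K !=set0); last first.
    exists 0 => // w Sw; rewrite mul0r addr0 ltNge; apply/negP => qw.
    by have : K w by []; rewrite K0.
  have [w1 /set_mem Kw1 qmin] := EVT_min_rV K0 cK (continuous_subspaceT cq).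
  have [w2 /set_mem Kw2 pmin] := EVT_min_rV K0 cK (continuous_subspaceT cp).
  have p2 : 0 < p w2.
    rewrite lt_def p_ge0 andbT; apply/negP; rewrite expf_eq0/= => /eqP u0.
    have [Sw2 /= qw2] := Kw2; suff : 0 < q w2 by rewrite ltNge qw2.
    apply: Hpos; first by rewrite -normr_gt0 Sw2.
    by apply/matrixP => i j; rewrite !ord1 u0 mxE.
  have q1 : q w1 <= 0 by case: Kw1.
  (* With [q w1] and [p w2] the minima over K, this choice gives c p >= 1 - q on K, hence q + c p >=
     1 there. *)
  exists ((1 - q w1) / p w2) => [|w Sw].
    by rewrite divr_ge0// subr_ge0 (le_trans q1).
  have [qw|qw] := leP (q w) 0; last first.
    by rewrite ltr_wpDr// mulr_ge0// divr_ge0// subr_ge0 (le_trans q1).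
  have Kw : w \in K by rewrite inE.
  have := qmin _ Kw; have := pmin _ Kw => pw qw1.
  have : (1 - q w1) / p w2 * p w2 <= (1 - q w1) / p w2 * p w.
    by rewrite ler_wpM2l// divr_ge0// subr_ge0 (le_trans q1).
  rewrite divfK ?gt_eqF//; lra.
have cqp : continuous (fun w => q w + c * p w).
  move=> w; apply: (@continuousD _ _ _ q (fun w => c * p w)); first exact: cq.
  by apply: (@continuousM _ _ (fun=> c) p); [exact: cst_continuous|exact: cp].
have [d d_gt0 dP] : exists2 d : R, 0 < d & forall w, S w -> d <= q w + c * p w.
  (* The sphere is empty in dimension 0, where any d works. *)
  have [S0|S0] := pselect (S !=set0); last first.
    by exists 1 => // w Sw; case: S0; exists w.
  have [w1 /set_mem Sw1 wmin] := EVT_min_rV S0 cS (continuous_subspaceT cqp).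
  by exists (q w1 + c * p w1) => [|w Sw]; [exact: cP|apply: wmin; rewrite inE].
exists c, d; split => // w.
have [->|w0] := eqVneq w 0.
  by rewrite normr0 expr0n /= mulr0 !mul0mx mxE expr0n mulr0 addr0.
have nw : 0 < `|w| by rewrite normr_gt0.
have := dP (`|w|^-1 *: w); rewrite /S /= normrZ normfV normr_id mulVf ?gt_eqF//.
move=> /(_ erefl).
have -> : q (`|w|^-1 *: w) = q w / `|w| ^+ 2.
  rewrite /q linearZ /= -!scalemxAl -scalemxAr scalerA mxE -invfM -expr2.
  exact: mulrC.
have -> : p (`|w|^-1 *: w) = p w / `|w| ^+ 2.
  by rewrite /p -scalemxAl mxE exprMn exprVn mulrC.
by rewrite mulrA -mulrDl ler_pdivlMr ?exprn_gt0.
Qed.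

(* As [- m < G z <= 0] near the point, [mu * - G z] dominates [c * G z ^+ 2],
   which replaces the penalty [c * l ^+ 2], [l] being the linearization of
   [G]. *)
Lemma SOSC_strict_local_min (R : realType) n (F G : 'rV[R]_n -> R)
    (a : 'rV[R]_n) (mu : R) (L := fun z => F z + mu * G z) :
  0 < mu ->
  (\forall z \near a, differentiable L z) ->
  (forall i, differentiable ('D_(delta_mx 0 i) L) a) ->
  differentiable G a -> G a = 0 -> grad L a = 0 ->
  (forall w : 'rV[R]_n, w != 0 -> w *m grad G a = 0 ->
     0 < (w *m hessian L a *m w^T) 0 0) ->
  \forall z \near a, G z <= 0 -> z <> a -> F a < F z.
Proof.
move=> mu0 dL ddL dG Ga0 La0 /positive_on_kernel_penalized[c [d [c0 d0 cd]]].
(* Half the penalized form supplies d/2 |w|^2. The Taylor error of L costs d/8 and the linearization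
   error of G, through the penalty, another d/8; d/4 |w|^2 is left over. Dividing by c + 1 rather
   than c allows c = 0. *)
pose e1 := d / 8; have e10 : 0 < e1 by rewrite divr_gt0.
pose e2 := Num.min 1 (d / (8 * (c + 1))).
have c10 : 0 < c + 1 by lra.
have e20 : 0 < e2 by rewrite lt_min ltr01 divr_gt0// mulr_gt0.
have e2c : c * e2 ^+ 2 <= d / 8.
  have : e2 <= 1 by rewrite ge_min lexx.
  have : e2 <= d / (8 * (c + 1)) by rewrite ge_min lexx orbT.
  rewrite invfM mulrA ler_pdivlMr// => h1 h2.
  by nra.
have T2 := differentiable_taylor2 dL ddL e10.
have T1 := differentiable_taylor1 dG e20.
pose m := mu / (c + 1); have m0 : 0 < m by rewrite divr_gt0.
have Gm : \forall w \near (0 : 'rV[R]_n), - m < G (a + w).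
  have : \forall z \near a, - m < G z.
    have /cvgr_gt := differentiable_continuous dG.
    by rewrite Ga0; apply; rewrite oppr_lt0.
  rewrite (near_shift (0 : 'rV[R]_n) a).
  by apply: filterS => w /=; rewrite subr0 addrC.
rewrite (near_shift (0 : 'rV[R]_n) a) /=; near=> w => /=.
rewrite subr0 [w + a]addrC => Gw wa.
have nw : 0 < `|w|.
  by rewrite normr_gt0; apply: contra_notN wa => /eqP ->; rewrite addr0.
have h2 : `|L (a + w) - L a - (w *m grad L a) 0 0
      - 2^-1 * (w *m hessian L a *m w^T) 0 0| <= e1 * `|w| ^+ 2 by near: w.
have h1 : `|G (a + w) - G a - (w *m grad G a) 0 0| <= e2 * `|w| by near: w.
have hG : - m < G (a + w) by near: w.
have := cd w.
move: h2; rewrite La0 mulmx0 [in X in X -> _]mxE subr0 ler_norml => /andP[h2 _].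
move: h1; rewrite Ga0 subr0 => h1.
move: h2; rewrite {1 2}/L Ga0 mulr0 addr0.
set q := (w *m hessian L a *m w^T) 0 0; set l := (w *m grad G a) 0 0 in h1 *.
set N := `|w| in nw h1 *; set g := G (a + w) in Gw hG h1 *.
move=> h2 h3.
have h4 : (g - l) ^+ 2 <= e2 ^+ 2 * N ^+ 2.
  by rewrite -exprMn -real_normK ?num_real// lerXn2r ?nnegrE// mulr_ge0// ltW.
have h5 : l ^+ 2 <= 2 * g ^+ 2 + 2 * (g - l) ^+ 2.
  have := sqr_ge0 (2 * g - l); lra.
have h6 : c * l ^+ 2 <= 2 * (c * g ^+ 2) + d / 4 * N ^+ 2.
  have : c * (g - l) ^+ 2 <= d / 8 * N ^+ 2.
    apply: (le_trans (ler_wpM2l c0 h4)).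
    by rewrite mulrA ler_wpM2r ?sqr_ge0.
  have := ler_wpM2l c0 h5; lra.
(* From -m < g <= 0 one gets (c + 1)(-g) <= mu; multiply by -g >= 0. *)
have h7 : c * g ^+ 2 <= - mu * g.
  have : (c + 1) * - g <= mu by rewrite mulrC -ler_pdivlMr// -/m; lra.
  move=> h; have := ler_wpM2r (_ : 0 <= - g) h.
  by nra.
have N2 : 0 < d * N ^+ 2 by rewrite mulr_gt0// exprn_gt0.
rewrite /e1 in h2; lra.
Unshelve. all: by end_near. Qed.

(** * Regularity of the reduced functions and linear algebra of multipliers *)

(** These are the hypotheses of [differentiable_taylor2]. They are stable under sums and products,
    hence pass from the coordinates of [Phi] to the objective and the stability constraint, both
    polynomial in x. *)
Definition twice_differentiable (R : realType) n (f : 'rV[R]_n -> R)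
    (a : 'rV[R]_n) : Prop :=
  (\forall z \near a, differentiable f z) /\
  forall i, differentiable ('D_(delta_mx 0 i) f) a.

Section TwiceDifferentiable.
Context {R : realType} {n : nat}.
Implicit Types (f g : 'rV[R]_n -> R) (a : 'rV[R]_n).

Lemma twice_differentiable_cst (c : R) a :
  twice_differentiable (fun=> c) a.
Proof.
split=> [|i]; first by near=> z; exact: differentiable_cst.
apply: (@near_eq_differentiable _ _ _ (cst 0)); last exact: differentiable_cst.
by near=> z; rewrite (derive_cst c z).
Unshelve. all: by end_near. Qed.

Lemma twice_differentiableD f g a :
  twice_differentiable f a -> twice_differentiable g a ->
  twice_differentiable (fun z => f z + g z) a.
Proof.
move=> [df ddf] [dg ddg]; split=> [|i].
  by near=> z; apply: (@differentiableD _ _ _ f g); near: z.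
apply: near_eq_differentiable (differentiableD (ddf i) (ddg i)).
near=> z; rewrite (@deriveD _ _ _ f g)//; apply: diff_derivable; near: z => //.
Unshelve. all: by end_near. Qed.

Lemma twice_differentiableM f g a :
  twice_differentiable f a -> twice_differentiable g a ->
  twice_differentiable (fun z => f z * g z) a.
Proof.
move=> [df ddf] [dg ddg]; split=> [|i].
  by near=> z; apply: (@differentiableM _ _ f g); near: z.
have df0 := nbhs_singleton df; have dg0 := nbhs_singleton dg.
apply: near_eq_differentiable (differentiableD (differentiableM df0 (ddg i))
  (differentiableM dg0 (ddf i))).
near=> z; rewrite (@deriveM _ _ f g)//; apply: diff_derivable; near: z => //.
Unshelve. all: by end_near. Qed.

Lemma twice_differentiable_sum (I : Type) (r : seq I) (P : pred I)
    (f : I -> 'rV[R]_n -> R) a :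
  (forall i, twice_differentiable (f i) a) ->
  twice_differentiable (fun z => \sum_(i <- r | P i) f i z) a.
Proof.
move=> df; elim: r => [|i r IH].
  under eq_fun do rewrite big_nil; exact: twice_differentiable_cst.
under eq_fun do rewrite big_cons.
by case: (P i) => //; exact: twice_differentiableD.
Qed.

Lemma twice_differentiable_coord m (f : 'rV[R]_n -> 'rV[R]_m) a j :
  (\forall z \near a, differentiable f z) ->
  (forall i, differentiable ('D_(delta_mx 0 i) f) a) ->
  twice_differentiable (fun z => f z 0 j) a.
Proof.
move=> df ddf; split=> [|i].
  near=> z; apply: (@differentiable_comp _ _ _ _ f (fun v => v 0 j)).
    by near: z.
  exact: differentiable_coord.
apply: (near_eq_differentiable _ (@differentiable_comp _ _ _ _ _
  (fun v : 'rV[R]_m => v 0 j) _ (ddf i) (differentiable_coord _ _ _))).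
near=> z; rewrite /= derive_mx ?mxE//; apply: diff_derivable; near: z => //.
Unshelve. all: by end_near. Qed.

End TwiceDifferentiable.

Lemma grad_comp (R : realType) m n (f : 'rV[R]_m -> 'rV[R]_n)
    (F : 'rV[R]_n -> R) (a : 'rV[R]_m) :
  differentiable f a -> differentiable F (f a) ->
  grad (fun z => F (f z)) a = 'J f a *m grad F (f a).
Proof.
move=> df dF; apply/matrixP => i j; rewrite ord1 mxE.
rewrite deriveE; last exact: (@differentiable_comp _ _ _ _ f F).
rewrite (@diff_comp _ _ _ _ f F)//= diffE_grad// -deriveE// deriveEjacobian//.
by rewrite -rowE !mxE; apply: eq_bigr => l _; rewrite mxE.
Qed.

(** The column space of M is the annihilator of its left kernel: the rows of the transposed cokernel
    of the transpose of M lie in that kernel, so u kills them. *)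
Lemma kernel_orthogonal_mulmx (R : fieldType) m n (M : 'M[R]_(n, m))
    (u : 'cV[R]_n) :
  (forall v : 'rV[R]_n, v *m M = 0 -> v *m u = 0) -> exists l, u = M *m l.
Proof.
move=> Mu; have /submxP[D uD] : (u^T <= M^T)%MS.
  rewrite submxE; apply/eqP/trmx_inj; rewrite trmx_mul trmxK trmx0.
  apply/row_matrixP => i; rewrite row_mul row0 Mu// -row_mul.
  by rewrite -[M]trmxK -trmx_mul trmxK mulmx_coker trmx0 row0.
by exists D^T; rewrite -[u]trmxK uD trmx_mul trmxK.
Qed.

Section OPFRegularity.
Context {R : realType} (O : opf R) {n : nat}.
Variables (f : 'rV[R]_n -> 'rV[R]_(xdim O)) (z : 'rV[R]_n).
Hypothesis f_coord : forall j, twice_differentiable (fun y => f y 0 j) z.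

Lemma twice_differentiable_Jobj a rho :
  twice_differentiable (fun y => Jobj a rho (f y)) z.
Proof.
apply: twice_differentiable_sum => k.
have dP : twice_differentiable (fun y => PG (f y) k) z.
  by under eq_fun do rewrite /PG !mxE.
have dQ : twice_differentiable (fun y => QG (f y) k) z.
  by under eq_fun do rewrite /QG !mxE.
have dc c := twice_differentiable_cst c z.
by do ![apply: twice_differentiableD|apply: twice_differentiableM].
Qed.

Lemma twice_differentiable_stab_con s :
  twice_differentiable (fun y => stab_con s (f y)) z.
Proof.
apply: twice_differentiableD; last exact: twice_differentiable_cst.
apply: twice_differentiable_sum => k.
apply: twice_differentiableM; first exact: twice_differentiable_cst.
by under eq_fun do rewrite /Vm !mxE.
Qed.

End OPFRegularity.

(** Taking [f := id] in the preceding section makes the objective and the stability constraint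
    differentiable in x itself, as the chain rule [grad_comp] requires. *)
Lemma twice_differentiable_id_coord (R : realType) n (z : 'rV[R]_n) j :
  twice_differentiable (fun y : 'rV[R]_n => y 0 j) z.
Proof.
apply: (@twice_differentiable_coord _ _ _ id) => [|i].
  by near=> y; exact: ex_diff.
apply: (@near_eq_differentiable _ _ _ (cst (delta_mx 0 i))).
  by near=> y; rewrite derive_id.
exact: differentiable_cst.
Unshelve. all: by end_near. Qed.

Lemma differentiable_Jobj (R : realType) (O : opf R) a rho x :
  differentiable (@Jobj R O a rho) x.
Proof.
have [+ _] := @twice_differentiable_Jobj R O _ id x
  (@twice_differentiable_id_coord _ _ x) a rho.
exact: nbhs_singleton.
Qed.

Lemma differentiable_stab_con (R : realType) (O : opf R) s x :
  differentiable (@stab_con R O s) x.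
Proof.
have [+ _] := @twice_differentiable_stab_con R O _ id x
  (@twice_differentiable_id_coord _ _ x) s.
exact: nbhs_singleton.
Qed.

(** * Transfer from the free variables to the feasible set *)

Theorem theorem2 (R : realType) (O : opf R) (s : 'I_(nstab O))
    (xs : 'rV[R]_(xdim O))
    (xs_eq : eqcon xs = 0)
    (xs_s : stab_con s xs = 0)
    (xs_strict : forall c : con O, c <> Stab s -> ineq c xs < 0)
    (xs_rank : row_free ('J (@eqcon R O) xs)^T)
    (k : nat) (Phi : 'rV[R]_k -> 'rV[R]_(xdim O)) (zs : 'rV[R]_k)
    (Phi_param : local_parametrization (@eqcon R O) xs Phi zs)
    (a : 'I_#|gens O| -> R) (a_ge0 : forall i, 0 <= a i)
    (A : 'M[R]_(k, rhodim O))
    (A_def : forall r : 'cV[R]_(rhodim O),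
       reduced_grad Phi zs (Jobj a r) = A *m r)
    (rho : 'cV[R]_(rhodim O))
    (rho_ge0 : forall i, [/\ 0 <= rho_b rho i, 0 <= rho_c rho i & 0 <= rho_d rho i])
    (rho_d_gt0 : exists i, 0 < rho_d rho i)
    (mu : R) (mu_gt0 : 0 < mu)
    (stationary : A *m rho + mu *: reduced_grad Phi zs (stab_con s) = 0)
    (sosc : reduced_SOSC Phi zs (Jobj a rho) (stab_con s) mu) :
  [/\ strict_local_minimizer (Jobj a rho) xs,
      independently_binding s xs
    & is_shadow_price (Jobj a rho) xs (Stab s) mu /\ 0 < mu].
Proof.
have [Phizs _ tangent [W [U [Psi [[oW Wzs] [oU Uxs] sPhi PhiW [cPsi PsiK]]]]]]
  := Phi_param.
have feas : feasible xs.
  split=> // c; have [->|/eqP cs] := eqVneq c (Stab s).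
    by rewrite /= xs_s.
  exact/ltW/xs_strict.
rewrite -A_def in stationary.
split; last split=> //.
- split=> //.
  pose F z := Jobj a rho (Phi z); pose G z := stab_con s (Phi z).
  have Phi_near : \forall z \near zs, differentiable Phi z.
    have : nbhs zs W by exact: open_nbhs_nbhs.
    by apply: filterS; have [] := sPhi 1%N.
  have Phi_coord j : twice_differentiable (fun z => Phi z 0 j) zs.
    apply: twice_differentiable_coord => // i.
    by have [_ /(_ i) [+ _]] := sPhi 2%N; apply.
  have [dF ddF] := twice_differentiable_Jobj Phi_coord a rho.
  have tG := twice_differentiable_stab_con Phi_coord s.
  have dG := nbhs_singleton (proj1 tG).
  have [dL ddL] : twice_differentiable (fun z => F z + mu * G z) zs.
    apply: twice_differentiableD; first exact: twice_differentiable_Jobj.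
    by apply: twice_differentiableM => //; exact: twice_differentiable_cst.
  have dPhi := nbhs_singleton Phi_near.
  have gradG : grad G zs = reduced_grad Phi zs (stab_con s).
    exact/grad_comp/differentiable_stab_con.
  have gradF : grad F zs = reduced_grad Phi zs (Jobj a rho).
    exact/grad_comp/differentiable_Jobj.
  have gradL : grad (fun z => F z + mu * G z) zs = 0.
    rewrite -stationary -gradG -gradF; apply/matrixP => i j; rewrite !mxE.
    have dFi : derivable F zs (delta_mx 0 i).
      by apply: diff_derivable; exact: nbhs_singleton dF.
    have dGi : derivable G zs (delta_mx 0 i) by exact: diff_derivable.
    rewrite (@deriveD _ _ _ F (mu *: G)) ?deriveZ//.
    exact: derivableZ.
  have Gzs : G zs = 0 by rewrite /G Phizs.
  have minz := SOSC_strict_local_min mu_gt0 dL ddL dG Gzs gradL.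
  have {}minz : \forall z \near zs, G z <= 0 -> z <> zs -> F zs < F z.
    apply: minz => w w0 wG; have := sosc w^T; rewrite trmxK; apply.
      by rewrite -(inj_eq (@trmx_inj _ _ _)) trmxK trmx0.
    by apply: trmx_inj; rewrite trmx_mul !trmxK trmx0 -gradG.
  have Axs : (U `&` [set x | eqcon x = 0]) xs by [].
  (* Continuity of the inverse chart pulls the neighbourhood of zs given by [minz] back to one of xs
     relative to g = 0. A feasible y there is [Phi z] with z in W, so [Psi y = z] and F(z) is the
     objective at y. *)
  have : Psi @ within (U `&` [set x | eqcon x = 0]) (nbhs xs) --> Psi xs.
    by move/subspace_continuousP: cPsi; exact.
  have -> : Psi xs = zs by rewrite -Phizs PsiK.
  move=> /(_ _ minz); rewrite /= /within /= => minx.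
  have nU : nbhs xs U by exact: open_nbhs_nbhs.
  near=> y => -[yeq yineq] yxs.
  have Uy : U y by near: y.
  have Ay : (U `&` [set x | eqcon x = 0]) y by [].
  have : (U `&` [set x | eqcon x = 0]) y -> G (Psi y) <= 0 -> Psi y <> zs ->
      F zs < F (Psi y) by near: y.
  move=> /(_ Ay); have := Ay; rewrite -PhiW => -[z Wz zy].
  rewrite -zy PsiK// /F /G Phizs zy; apply; first exact: (yineq (Stab s)).
  by move=> zzs; apply: yxs; rewrite -zy zzs.
- move=> c; split=> [c0|->//].
  have [->//|/eqP /xs_strict] := eqVneq c (Stab s).
  by rewrite c0 ltxx.
(* A vector v killed by the Jacobian of g is tangent, v = D J_Phi, and stationarity says J_Phi
   annihilates grad J + mu grad h_s. *)
- have [l lE] : exists l, grad (Jobj a rho) xs + mu *: grad (stab_con s) xs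
                 = 'J (@eqcon R O) xs *m l.
    apply: kernel_orthogonal_mulmx => v /tangent/submxP[D ->].
    rewrite -mulmxA mulmxDr -scalemxAr -[X in grad _ X]Phizs.
    rewrite -[X in _ *: ('J _ _ *m grad _ X)]Phizs.
    by move: stationary; rewrite /reduced_grad => ->; rewrite mulmx0.
  (* Complementary slackness holds because h_s vanishes at xs and every other inequality gets
     multiplier 0. *)
  exists (- l), (fun c => if c == Stab s then mu else 0); rewrite eqxx; split=> //.
  split=> //.
  + rewrite (bigD1 (Stab s))//= eqxx big1 => [|c /negPf->]; last by rewrite scale0r.
    by rewrite addr0 mulmxN addrAC lE subrr.
  + by move=> c; case: ifP => // _; exact: ltW.
  + move=> c; case: eqP => [->|_]; last by rewrite mul0r.
    by rewrite /= xs_s mulr0.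
Unshelve. all: by end_near. Qed.
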